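(* Let $\mathcal A$ be a cyclotomic S-ring with trivial radical over a finite cyclic group $G$, and let $S$ be an $\mathcal A$-section such that $S_p\ne 1$ for every odd prime divisor $p$ of $|G|$. Then: (1) $|\mathrm{rad}(\mathcal A_S)|\le 2$; (2) $|\mathrm{rad}(\mathcal A_S)|=1$ unless $|S_2|=4$.
   Context: An S-ring over a finite group $G$ is a subring $\mathcal A$ of $\mathbb Z G$ spanned by the sums $\underline X=\sum_{x\in X}x$ over the blocks $X$ of a partition of $G$ (basic sets) containing $\{e\}$ and closed under $X\mapsto X^{-1}$. An $\mathcal A$-group is a subgroup that is a union of basic sets; an $\mathcal A$-section is $U/L$ with $L\le U$ $\mathcal A$-groups, with restriction $\mathcal A_{U/L}$ the S-ring over $U/L$ whose basic sets are the images of basic sets contained in $U$. $\mathcal A$ is cyclotomic if its basic sets are the orbits of some subgroup of $\mathrm{Aut}(G)$. For $X\subseteq G$, $\mathrm{rad}(X)=\{g: gX=X\}$; for an S-ring over a cyclic group, its radical is the radical of any basic set containing a generator of the group. For a cyclic group $S$ and prime $p$, $S_p$ denotes its Sylow $p$-subgroup. *)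

(* Defs.v *)
From mathcomp Require Import all_boot all_order all_fingroup all_algebra all_solvable.

Set Implicit Arguments.
Unset Strict Implicit.
Unset Printing Implicit Defensive.

Import GroupScope.

(* Elements of the integral group ring are represented as functions
   [{ffun gT -> int}], with their pointwise addition; the pointwise product of
   finite functions is not the ring product, which is the convolution below. *)
Definition gring_mul (gT : finGroupType) (a b : {ffun gT -> int}) :
    {ffun gT -> int} :=
  [ffun z => (\sum_(x : gT) a x * b (x^-1 * z)%g)%R].

Definition gring_sum (gT : finGroupType) (X : {set gT}) : {ffun gT -> int} :=
  [ffun x => (x \in X)%:R%R].

(* Integer multiples are written [*~] because [{ffun gT -> int}] is used only
   as an additive group. *)
Definition in_span (gT : finGroupType) (A : {set {set gT}})
    (a : {ffun gT -> int}) : Prop :=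
  exists c : {set gT} -> int, a = (\sum_(X in A) gring_sum X *~ c X)%R.

(* An S-ring is represented by the set of its basic sets: the subring itself is
   [in_span A], which is an additive subgroup by construction and contains the
   unit of the group ring because [set 1] is a basic set. *)
Definition is_sring (gT : finGroupType) (G : {set gT}) (A : {set {set gT}}) :
    Prop :=
  [/\ partition A G,
      [set 1] \in A,
      forall X, X \in A -> X^-1 \in A
    & forall a b, in_span A a -> in_span A b -> in_span A (gring_mul a b)].

Definition cyclotomic (gT : finGroupType) (G : {set gT}) (A : {set {set gT}}) :
    Prop :=
  exists2 K : {group {perm gT}}, K \subset Aut G & A = orbit 'P K @: G.

Definition is_Agroup (gT : finGroupType) (A : {set {set gT}}) (H : {group gT}) :
    Prop :=
  exists2 B : {set {set gT}}, B \subset A & H :=: cover B.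

Definition is_Asection (gT : finGroupType) (A : {set {set gT}})
    (U L : {group gT}) : Prop :=
  [/\ is_Agroup A U, is_Agroup A L & L \subset U].

Definition restr (gT : finGroupType) (A : {set {set gT}}) (U L : {group gT}) :
    {set {set coset_of L}} :=
  [set X / L | X : {set gT} in A & X \subset U].

Definition rad (gT : finGroupType) (X : {set gT}) : {set gT} :=
  [set g | g *: X == X].

(* The radical of an S-ring over a cyclic group does not depend on the basic
   set chosen; as a relation, the definition does not presuppose this fact. *)
Definition is_radical (gT : finGroupType) (G : {set gT}) (A : {set {set gT}})
    (R : {set gT}) : Prop :=
  exists X x, [/\ X \in A, x \in X, generator G x & R = rad X].

(* Main.v *)
Require Import Defs.
From mathcomp Require Import all_boot all_order all_fingroup all_algebra all_solvable.

Set Implicit Arguments.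
Unset Strict Implicit.
Unset Printing Implicit Defensive.

Import GroupScope.

(** The automorphisms of a cyclic group are power maps, so the basic sets of
    generators of [G] and of [S = U / L] are [x ^+ E] and [y ^+ E] for the same
    multiplicative set [E] of exponents prime to [n = #|G|].  Let [m = #|S|].
    An element of prime order [p] in the radical of the section forces
    [p ^ 2 %| m] and yields [e] in [E] with [e = 1] modulo [m / p] but not modulo
    [m].  If [p] is odd or [8 %| m], lifting the exponent turns [e] into a power
    [e ^ N] which is [1] modulo [n / p] but not modulo [n], since the odd primes
    dividing [n] divide [m]; then [x ^+ (e ^ N - 1)] is a nontrivial element of
    the radical over [G].  Hence [p = 2] and [#|S_2| = 4], and the radical of the
    section is not the whole of [S_2], because [y] times the inverse of its
    2-part is not a generator. *)

(** * Lifting the exponent: [p]-adic valuations of powers minus one *)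

Section Arithmetic.

Local Open Scope nat_scope.

Lemma expnE_geom x k : 0 < x -> x ^ k = (x.-1 * \sum_(i < k) x ^ i).+1.
Proof. by move=> x_gt0; rewrite -predn_exp prednK // expn_gt0 x_gt0. Qed.

Lemma sum_expn_modn d x k : 0 < x -> d %| x.-1 ->
  \sum_(i < k) x ^ i = k %[mod d].
Proof.
move=> x_gt0 d_x1; elim: k => [|k IHk]; first by rewrite big_ord0.
rewrite big_ord_recr /= -modnDm IHk (expnE_geom _ x_gt0) -add1n.
by rewrite modnDm addnA (eqP (_ : _ == k.+1 %[mod d])) // addn1 -{2}[k.+1]addn0
  eqn_modDl mod0n -/(dvdn _ _) dvdn_mulr.
Qed.

(** The cofactor of [x.-1] is a geometric sum congruent to [k] modulo [p], hence prime to [p]. *)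
Lemma logn_pred_exp_coprime p x k : prime p -> 1 < x -> p %| x.-1 ->
  ~~ (p %| k) -> logn p (x ^ k).-1 = logn p x.-1.
Proof.
move=> p_pr x_gt1 p_x1 pNk; have x_gt0 := ltnW x_gt1.
have pNS: ~~ (p %| \sum_(i < k) x ^ i).
  by rewrite /dvdn sum_expn_modn.
rewrite predn_exp lognM; first
  by rewrite (lognE p (\sum_(i < k) _)) (negPf pNS) !andbF addn0.
  by case: x x_gt1 {x_gt0 p_x1 pNS} => [|[]].
by rewrite lt0n; apply: contraNneq pNS => ->.
Qed.

(* The geometric sum [\sum_(i < p) x ^ i] is congruent to [p] modulo [p ^ 2]. *)
Lemma logn_pred_exp_prime p x : prime p -> 1 < x -> p %| x.-1 ->
  odd p || (p ^ 2 %| x.-1) -> logn p (x ^ p).-1 = (logn p x.-1).+1.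
Proof.
move=> p_pr x_gt1 p_x1 odd_p2; have x_gt0 := ltnW x_gt1.
have sumE: \sum_(i < p) x ^ i = p + x.-1 * \sum_(i < p) \sum_(j < i) x ^ j.
  under eq_bigr => i _ do rewrite (expnE_geom i x_gt0) -add1n.
  by rewrite big_split sum_nat_const card_ord muln1 big_distrr.
have p2_rest: p ^ 2 %| x.-1 * \sum_(i < p) \sum_(j < i) x ^ j.
  case/orP: odd_p2 => [p_odd|]; last exact: dvdn_mulr.
  rewrite expnS expn1 dvdn_mul //.
  (* Modulo [p] each inner sum is [i]; the outer one becomes the binomial coefficient of [p] over 2,
     a multiple of [p] when [p] is odd. *)
  have ->: (p %| \sum_(i < p) \sum_(j < i) x ^ j) = (p %| \sum_(i < p) i).
    rewrite /dvdn; congr (_ == 0).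
    elim/big_ind2: _ => [//|a b c d e1 e2|i _]; last exact: sum_expn_modn.
    by rewrite -modnDm e1 e2 modnDm.
  rewrite -(big_mkord xpredT id) bin2_sum prime_dvd_bin //=.
  by rewrite ltn_neqAle prime_gt1 // andbT; apply: contraTneq p_odd => <-.
have logS: logn p (\sum_(i < p) x ^ i) = 1.
  case/dvdnP: p2_rest => c; rewrite sumE => ->.
  have ->: p + c * p ^ 2 = p * (c * p + 1).
    by rewrite addnC mulnDr muln1 mulnCA -mulnn.
  rewrite lognM ?(prime_gt0 p_pr) ?addn_gt0 ?orbT // logn_prime ?eqxx //.
  by rewrite (@logn_coprime p (_ + _)) // /coprime gcdnMDl gcdn1.
rewrite predn_exp lognM ?logS ?addn1 //; first
  by case: x x_gt1 {x_gt0 p_x1 odd_p2 sumE p2_rest logS} => [|[]].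
by rewrite lt0n; apply: contra_eq_neq logS => ->; rewrite logn0.
Qed.

Lemma logn_pred_exp_pexp p x j : prime p -> 1 < x -> p %| x.-1 ->
  odd p || (p ^ 2 %| x.-1) -> logn p (x ^ (p ^ j)).-1 = logn p x.-1 + j.
Proof.
move=> p_pr x_gt1 p_x1 odd_p2; elim: j => [|j IHj].
  by rewrite expn1 addn0.
have dvd_exp d : d %| x.-1 -> d %| (x ^ p ^ j).-1.
  by move=> d_x1; rewrite predn_exp dvdn_mulr.
rewrite expnSr expnM logn_pred_exp_prime ?IHj ?addnS ?(dvd_exp _ p_x1) //.
  by rewrite -(exp1n (p ^ j)) ltn_exp2r // expn_gt0 prime_gt0.
by case/orP: odd_p2 => [-> //|/dvd_exp p2_dvd]; rewrite p2_dvd orbT.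
Qed.

(** Induction peeling off a prime: for [s = t * q], [(x ^ s).-1] is [(x ^ t).-1], a multiple of [t],
    times a sum of [q] powers of [x ^ t], each congruent to 1 modulo [q]. *)
Lemma dvdn_pred_exp_self x s : 0 < x -> 0 < s ->
  (forall q, prime q -> q %| s -> q %| x.-1) -> s %| (x ^ s).-1.
Proof.
move=> x_gt0; elim/ltn_ind: s => s IHs s_gt0 dvd_x1.
have [s_gt1|] := ltnP 1 s; last by case: s s_gt0 {IHs dvd_x1} => [|[]].
have q_pr := pdiv_prime s_gt1; set q := pdiv s in q_pr.
have q_s: q %| s := pdiv_dvd s; have /dvdnP[t s_tq] := q_s.
have t_gt0: 0 < t by move: s_gt0; rewrite s_tq muln_gt0 => /andP[].
have t_dvd: t %| (x ^ t).-1.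
  apply: IHs => //; first by rewrite s_tq ltn_Pmulr ?prime_gt1.
  by move=> r r_pr r_t; apply: dvd_x1; rewrite // s_tq dvdn_mulr.
rewrite {2}s_tq expnM predn_exp s_tq dvdn_mul // /dvdn sum_expn_modn ?modnn //.
  by rewrite expn_gt0 x_gt0.
by rewrite predn_exp dvdn_mulr // dvd_x1.
Qed.

Lemma exp_eq1_mod_lift n m p e :
    0 < n -> m %| n -> prime p -> p %| m -> p %| m %/ p ->
    odd p || (p ^ 2 %| m %/ p) ->
    (forall q, prime q -> odd q -> q %| n -> q %| m) ->
    coprime n e -> 0 < e -> m %/ p %| e.-1 -> ~~ (m %| e.-1) ->
  exists N, (n %/ p %| (e ^ N).-1) && ~~ (n %| (e ^ N).-1).
Proof.
move=> n_gt0 m_n p_pr p_m p_mp odd_p2 odd_nm co_ne e_gt0 mp_e mNe.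
have m_gt0 := dvdn_gt0 n_gt0 m_n; have p_n := dvdn_trans p_m m_n.
have e_gt1: 1 < e by case: e e_gt0 mNe {co_ne mp_e} => [|[]] //; rewrite dvdn0.
have e1_gt0: 0 < e.-1 by rewrite -subn1 subn_gt0.
have mpK: m %/ p * p = m := divnK p_m.
have mp_gt0: 0 < m %/ p by rewrite divn_gt0 ?prime_gt0 // dvdn_leq.
have log_m: logn p m = (logn p (m %/ p)).+1.
  by rewrite -{1}mpK lognM ?(prime_gt0 p_pr) // (logn_prime p p_pr) eqxx addn1.
(* A larger valuation would give [m %| e.-1], because [m] and [m %/ p] have the same [p']-part. *)
have log_e: logn p e.-1 = logn p (m %/ p).
  apply/eqP; rewrite eqn_leq (dvdn_leq_log p e1_gt0 mp_e) andbT leqNgt -log_m.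
  apply: contra mNe; rewrite -pfactor_dvdn // => p_e.
  rewrite -(partnC p m_gt0) Gauss_dvd ?coprime_partC // p_part p_e /=.
  apply: dvdn_trans mp_e; rewrite -{1}mpK partnM ?(prime_gt0 p_pr) //.
  by rewrite [p`_ _]part_p'nat ?pnatNK ?pnat_id // muln1 dvdn_part.
(* The factor [s] makes the [p']-part of [n] divide [(e ^ N).-1] without changing the [p]-adic
   valuation; the power of [p] raises that valuation from [logn p m - 1] to exactly
   [logn p n - 1]. *)
pose s := n`_p^'; pose N := p ^ (logn p n - logn p m) * s; exists N.
have s_gt0: 0 < s := part_gt0 _ _.
have pNs: ~~ (p %| s) by rewrite -p'natE // part_pnat.
have s_e: s %| (e ^ s).-1.
  apply: dvdn_pred_exp_self => // q q_pr q_s.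
  have q_n: q %| n := dvdn_trans q_s (dvdn_part _ _).
  have [q_odd|] := boolP (odd q).
    apply: dvdn_trans mp_e; have := odd_nm q q_pr q_odd q_n.
    rewrite -{1}mpK Euclid_dvdM // (dvdn_prime2 q_pr p_pr) => /orP[//|/eqP qp].
    by rewrite -qp q_s in pNs.
  move/(prime_oddPn q_pr)=> q2; rewrite q2 dvdn2.
  by have := coprime_dvdl q_n co_ne; rewrite q2 coprime2n -{1}(prednK e_gt0).
have s_eN: s %| (e ^ N).-1 by rewrite /N mulnC expnM predn_exp dvdn_mulr.
have le_log: logn p m <= logn p n by rewrite dvdn_leq_log.
have eN_gt0: 0 < (e ^ N).-1.
  rewrite -subn1 subn_gt0 -(exp1n N) ltn_exp2r //.
  by rewrite muln_gt0 expn_gt0 prime_gt0.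
have log_eN: (logn p (e ^ N).-1).+1 = logn p n.
  have p_e: p %| e.-1 := dvdn_trans p_mp mp_e.
  rewrite /N expnM logn_pred_exp_coprime //; last first.
  - by rewrite predn_exp dvdn_mulr.
  - rewrite -(exp1n (p ^ (logn p n - logn p m))) ltn_exp2r //.
    by rewrite expn_gt0 prime_gt0.
  rewrite logn_pred_exp_pexp // ?log_e -?addSn -?log_m ?subnKC //.
  by case/orP: odd_p2 => [-> //|/dvdn_trans/(_ mp_e)->]; rewrite orbT.
have nE: n = p ^ (logn p (e ^ N).-1).+1 * s by rewrite log_eN -p_part partnC.
rewrite [in n %/ p]nE [in n %| _]nE expnS -mulnA mulKn ?prime_gt0 //.
have co_s j: coprime (p ^ j) s by rewrite coprimeXl // prime_coprime.
rewrite mulnA -expnS !Gauss_dvd // s_eN !andbT.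
by rewrite !pfactor_dvdn // leqnn ltnn.
Qed.

End Arithmetic.

(** * Automorphisms of a cyclic group as power maps, and radicals of orbits *)

Section PowerOrbits.

Variable gT : finGroupType.
Implicit Types (G : {group gT}) (K : {group {perm gT}}) (X : {set gT}).

Lemma Aut_cyclic_expg G f : cyclic G -> f \in Aut G ->
  exists e, [/\ 0 < e, coprime #|G| e & {in G, forall z, f z = z ^+ e}]%N.
Proof.
case/cyclicP=> x defG fAut.
have Gx: x \in G by rewrite defG cycle_id.
have ox: #|G| = #[x] by rewrite orderE defG.
have /cycleP[e fx]: f x \in <[x]> by rewrite -defG Aut_closed.
have f_exp: {in G, forall z, f z = z ^+ e}.
  move=> z; rewrite {1}defG => /cycleP[i ->].
  by rewrite -(autmE fAut) morphX // expgAC -fx.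
(* Adding [#|G|] keeps the power map and makes the exponent positive even for trivial [G]. *)
exists (e + #|G|)%N; split.
- by rewrite addn_gt0 cardG_gt0 orbT.
- rewrite /coprime gcdnDr -/(coprime _ _) ox -generator_coprime -fx -defG.
  rewrite /generator eq_sym eqEcard cycle_subG Aut_closed //= -orderE ox.
  by rewrite -(autmE fAut) order_injm ?injm_autm.
- by move=> z Gz; rewrite expgD expg_cardG // mulg1 f_exp.
Qed.

Lemma in_rad X g : (g \in Defs.rad X) = (g *: X \subset X).
Proof. by rewrite inE eqEcard card_lcoset leqnn andbT. Qed.

Lemma rad_mul X g h : g \in Defs.rad X -> h \in X -> g * h \in X.
Proof. by rewrite inE => /eqP defX Xh; rewrite -defX mem_lcoset mulKg. Qed.

Lemma rad_group_set X : group_set (Defs.rad X).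
Proof.
apply/group_setP; split=> [|g h]; first by rewrite inE mul1g.
by rewrite !inE => /eqP gX /eqP hX; rewrite lcosetM hX gX.
Qed.

Canonical rad_group X := Group (rad_group_set X).

(* If [q] did not divide [f], some [y ^+ (1 + f * i)] in [X] would have its
   exponent divisible by [q], hence would not generate [<[y]>]. *)
Lemma rad_expg_dvd X y f q : y \in X ->
    (forall w, w \in X -> exists2 e, coprime #[y] e & w = y ^+ e) ->
    y ^+ f \in Defs.rad X -> prime q -> q %| #[y] -> q %| f.
Proof.
move=> Xy Xgen radf q_pr q_y; apply: contraLR isT => qNf.
have [i _] := Bezoutl f (prime_gt0 q_pr).
have /eqP-> : coprime q f by rewrite prime_coprime.
move=> q_fi.
have Xi: (y ^+ f) ^+ i * y \in X.
  by elim: i {q_fi} => [|i IHi]; rewrite ?mul1g // expgS -mulgA rad_mul.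
have [e co_e] := Xgen _ Xi; rewrite -expgM -expgSr => /eqP.
rewrite eq_expg_mod_order => e_mod.
have := coprime_dvdl q_y co_e; rewrite prime_coprime // /dvdn.
rewrite -(modn_dvdm e q_y) -(eqP e_mod) modn_dvdm //.
by rewrite -addn1 addnC mulnC (eqP q_fi).
Qed.

(** Since [e.-1 ^ 2] vanishes modulo [#|G|], [e ^ i] is [1 + e.-1 * i] there. For [x ^+ w] in the
    orbit and [i] inverse to [w], applying [k ^+ i] adds [e.-1 * i * w], that is [e.-1], to the
    exponent. *)
Lemma expg_rad_orbit G K x k e : generator G x -> K \subset Aut G ->
    k \in K -> (0 < e)%N -> {in G, forall z, k z = z ^+ e} ->
    #|G| %| e.-1 ^ 2 -> x ^+ e.-1 \in Defs.rad (orbit 'P K x).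
Proof.
move=> genx sKA Kk e_gt0 k_exp n_e2.
have cycG: cyclic G by apply/cyclicP; exists x; apply/eqP.
have ox: #[x] = #|G| by rewrite orderE (eqP genx).
have Gx: x \in G by rewrite (eqP genx) cycle_id.
rewrite in_rad; apply/subsetP=> _ /lcosetP[_ /orbitP[k' Kk' <-] ->] /=.
have [w [_ co_w k'_exp]] := Aut_cyclic_expg cycG (subsetP sKA _ Kk').
pose i := (w ^ (totient #|G|).-1)%N.
have iw: (i * w = 1 %[mod #|G|])%N.
  rewrite /i mulnC -expnS prednK ?totient_gt0 ?cardG_gt0 //.
  by apply: Euler_exp_totient; rewrite coprime_sym.
apply/orbitP; exists (k' * k ^+ i); first by rewrite groupM ?groupX.
have ki j: {in G, forall z, (k ^+ j) z = z ^+ (e ^ j)%N}.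
  move=> z Gz; elim: j => [|j IHj]; first by rewrite perm1.
  by rewrite expgSr permM IHj k_exp ?groupX // -expgM expnSr.
rewrite /= !apermE permM k'_exp // ki ?groupX // -expgM -expgD.
apply/eqP; rewrite eq_expg_mod_order ox (expnE_geom _ e_gt0) mulnS addnC.
rewrite eqn_modDr; apply/eqP.
have eS: (e.-1 * \sum_(j < i) e ^ j = e.-1 * i %[mod #|G|])%N.
  rewrite -(modn_dvdm _ n_e2) -[RHS](modn_dvdm _ n_e2) -mulnn -!muln_modr.
  by rewrite sum_expn_modn.
by rewrite mulnC -modnMml eS modnMml -mulnA -modnMmr iw modnMmr muln1.
Qed.

End PowerOrbits.

(** * The radical of the section, compared with that of [G] *)

Theorem theorem7p3 (gT : finGroupType) (G : {group gT}) (A : {set {set gT}})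
    (U L : {group gT})
    (cycG : cyclic G) (sringA : is_sring G A) (cyclA : cyclotomic G A)
    (radA : is_radical G A 1) (secUL : is_Asection A U L)
    (oddUL : forall (p : nat) (Q : {group coset_of L}),
       prime p -> odd p -> p %| #|G| -> p.-Sylow(U / L) Q -> Q :!=: 1)
    (R : {set coset_of L}) (radR : is_radical (U / L) (restr A U L) R)
    (T : {group coset_of L}) (sylT : 2.-Sylow(U / L) T) :
  (#|R| <= 2)%N /\ (#|T| <> 4 -> #|R| = 1%N).
Proof.
case: cyclA => K sKA defA.
case: radA => X [x [AX Xx genx radX]].
have{AX Xx} defX: X = orbit 'P K x.
  by move: AX Xx; rewrite defA => /imsetP[x' _ ->] /orbit_eqP->.
have ox: #[x] = #|G| by rewrite orderE (eqP genx).
have sUG: U \subset G.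
  case: secUL => [[B sBA ->] _ _]; have [/and3P[/eqP<- _ _] _ _ _] := sringA.
  by apply/bigcupsP=> Z BZ; rewrite bigcup_sup // (subsetP sBA).
case: radR => Y [y [/imsetP[X1 AX1U defY] Yy geny ->]] {R}.
have [AX1 sX1U] : X1 \in A /\ X1 \subset U by apply/andP; rewrite inE in AX1U.
have oy: #[y] = #|U / L| by rewrite orderE (eqP geny).
have y_m_n: #[y] %| #|G| by rewrite oy (dvdn_trans (dvdn_quotient _ _)) ?cardSg.
(* The exponent comes from an automorphism of all of [G], so it is prime to [#|G|] and acts on [x]
   as well as on [y]. *)
have Ygen w: w \in Y -> exists k e, [/\ k \in K, (0 < e)%N, coprime #|G| e,
    {in G, forall z, k z = z ^+ e} & w = y ^+ e].
  move: Yy; rewrite defY => /morphimP[z Nz X1z ->] /morphimP[z1 _ X1z1 ->].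
  have X1_orb: X1 = orbit 'P K z.
    by move: AX1 X1z; rewrite defA => /imsetP[z' _ ->] /orbit_eqP->.
  move: X1z1; rewrite X1_orb => /orbitP[k Kk <-].
  have [e [e_gt0 co_e k_exp]] := Aut_cyclic_expg cycG (subsetP sKA _ Kk).
  exists k, e; split=> //; rewrite -morphX //= /aperm k_exp //.
  exact: subsetP (subset_trans sX1U sUG) _ X1z.
have radY r: r \in Defs.rad Y -> exists k e, [/\ k \in K, (0 < e)%N,
    coprime #|G| e, {in G, forall z, k z = z ^+ e} & r = y ^+ e.-1].
  move=> Rr; have [k [e [Kk e_gt0 co_e k_exp]]] := Ygen _ (rad_mul Rr Yy).
  rewrite -{1}(prednK e_gt0) expgSr => /mulIg defr.
  by exists k, e.
have radY_dvd f q: y ^+ f \in Defs.rad Y -> prime q -> q %| #[y] -> q %| f.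
  apply: rad_expg_dvd Yy _ => w /Ygen[k [e [_ _ co_e _ ->]]].
  by exists e; rewrite // (coprime_dvdl y_m_n).
have odd_dvd q: prime q -> odd q -> q %| #|G| -> q %| #[y].
  move=> q_pr q_odd q_n; have [Q sylQ] := Sylow_exists q (U / L).
  have [sQUL qQ _] := and3P sylQ.
  have ntQ := oddUL q Q q_pr q_odd q_n sylQ.
  have [_ q_Q _] := pgroup_pdiv qQ ntQ.
  by rewrite oy (dvdn_trans q_Q) ?cardSg.
have order2 r: r \in Defs.rad Y -> prime #[r] ->
    [/\ #[r] = 2, #|T| = 4 & ~~ (8 %| #[y])].
  move=> Rr p_pr; have [k [e [Kk e_gt0 co_e k_exp defr]]] := radY r Rr.
  have := orderXdvd y e.-1; have := orderXgcd y e.-1.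
  rewrite -defr; set p := #[r] in p_pr * => p_def p_m.
  have mp_gcd: (#[y] %/ p = gcdn #[y] e.-1)%N.
    by rewrite p_def divnA ?dvdn_gcdl // mulKn.
  have p_e: p %| e.-1 by apply: radY_dvd p_pr p_m; rewrite -defr.
  have p_mp: p %| #[y] %/ p by rewrite mp_gcd dvdn_gcd p_m.
  have mp_e: #[y] %/ p %| e.-1 by rewrite mp_gcd dvdn_gcdr.
  have mNe: ~~ (#[y] %| e.-1).
    by rewrite order_dvdn -defr -order_eq1 gtn_eqF ?prime_gt1.
  have: ~~ (odd p || (p ^ 2 %| #[y] %/ p)%N).
    apply/negP=> odd_p2.
    have [N /andP[np_eN /negP[]]] := exp_eq1_mod_lift (cardG_gt0 G) y_m_n p_pr
      p_m p_mp odd_p2 odd_dvd co_e e_gt0 mp_e mNe.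
    (* This makes [#|G|] divide the square of any multiple of [#|G| %/ p], as [expg_rad_orbit]
       requires. *)
    have p_np: p %| #|G| %/ p.
      by rewrite (dvdn_trans p_mp) // dvdn_divRL ?divnK // (dvdn_trans p_m).
    have kN: {in G, forall z, (k ^+ N) z = z ^+ (e ^ N)%N}.
      move=> z Gz; elim: (N) => [|j IHj]; first by rewrite perm1.
      by rewrite expgSr permM IHj k_exp ?groupX // -expgM expnSr.
    suffices: x ^+ (e ^ N).-1 \in Defs.rad X.
      by rewrite -radX => /set1P/eqP; rewrite -order_dvdn ox.
    rewrite defX.
    apply: expg_rad_orbit (kN) _ => //; rewrite ?groupX ?expn_gt0 ?e_gt0 //.
    rewrite -mulnn -(divnK (dvdn_trans p_m y_m_n)) dvdn_mul //.
    exact: dvdn_trans np_eN.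
  rewrite negb_or => /andP[/(prime_oddPn p_pr) p2].
  rewrite p2 in p_m p_mp *; rewrite !dvdn_divRL // => m8.
  split=> //; rewrite (card_Hall sylT) -oy p_part.
  move: m8; rewrite dvdn_divRL // in p_mp.
  rewrite -expnSr pfactor_dvdn ?order_gt0 // -leqNgt => le2.
  have ge2: (2 <= logn 2 #[y])%N by rewrite -pfactor_dvdn.
  by rewrite (_ : logn 2 _ = 2) //; apply/eqP; rewrite eqn_leq le2.
have rad1 p: prime p -> p %| #|Defs.rad Y| ->
    [/\ p = 2, #|T| = 4 & ~~ (8 %| #[y])].
  move=> p_pr /(@Cauchy _ _ (rad_group Y) p_pr)[r Rr ord_r].
  by have := order2 r Rr; rewrite ord_r; apply.
have sRy: Defs.rad Y \subset <[y]>.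
  by apply/subsetP=> r /radY[k [e [_ _ _ _ ->]]]; apply: mem_cycle.
split=> [|T4]; last first.
  apply/eqP; rewrite eqn_leq cardG_gt0 andbT leqNgt; apply/negP=> R_gt1.
  by have [] := rad1 _ (pdiv_prime R_gt1) (pdiv_dvd _).
have R2: 2.-nat #|Defs.rad Y|.
  by apply/pnatP=> [|p p_pr /(rad1 _ p_pr)[->]]; rewrite ?cardG_gt0.
have [r defR] := cyclicP (cyclicS sRy (cycle_cyclic y)).
have Rr: r \in Defs.rad Y by rewrite defR cycle_id.
have [k [e [_ _ _ _ defr]]] := radY r Rr.
have [c cardR] := p_natP R2; rewrite cardR.
case: c cardR => [|[|c]] // cardR.
have R_2: 2 %| #|Defs.rad Y| by rewrite cardR expnS dvdn_mulr.
have [_ _ /negP[]] := rad1 2 isT R_2.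
(* A radical of order at least 4 is excluded: [#[y]] is [#[r]] times [gcdn #[y] e.-1], and this gcd
   is even by [radY_dvd], so 8 would divide [#[y]]. *)
have ord_r: #[r] = (2 ^ c.+2)%N by rewrite -cardR defR.
have m_2: 2 %| #[y] by rewrite (dvdn_trans R_2) ?cardSg.
have := orderXgcd y e.-1; rewrite -defr ord_r => /eqP.
rewrite eq_sym -eqn_mul ?gcdn_gt0 ?order_gt0 ?dvdn_gcdl // => /eqP->.
rewrite (_ : 8 = 2 ^ 2 * 2)%N // dvdn_mul ?dvdn_exp2l //.
by rewrite dvdn_gcd m_2 radY_dvd // -defr.
Qed.
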